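(* Let $u$ be a fuzzy number and let $v$ be a Lipschitz fuzzy number with Lipschitz constant $K$. If $v(v^-(0))\le u(u^-(0))$ and $v(v^+(0))\le u(u^+(0))$, then $u\nabla v$ is also a Lipschitz fuzzy number.
   Context: A fuzzy number is a map $u:\mathbb{R}\to[0,1]$ such that, writing $[u]_\alpha=\{x:u(x)\ge\alpha\}$ for $\alpha\in(0,1]$ and $[u]_0=\overline{\{x:u(x)>0\}}$, the set $[u]_1$ is nonempty and each $[u]_\alpha=[u^-(\alpha),u^+(\alpha)]$, $\alpha\in[0,1]$, is a compact interval. A fuzzy number $u$ is Lipschitz (with Lipschitz constant $K$) if $|u(x)-u(y)|\le K|x-y|$ for all $x,y\in[u]_0$. The sup-min convolution is $(u\nabla v)(x)=\sup_{y\in\mathbb{R}}\min\{u(y),v(x-y)\}$; it is a fuzzy number with $[u\nabla v]_\alpha=[u]_\alpha+[v]_\alpha$. *)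

(* Defs.v *)
From mathcomp Require Import all_boot all_order all_algebra.
From mathcomp Require Import all_classical all_reals all_analysis.

Set Implicit Arguments.
Unset Strict Implicit.
Unset Printing Implicit Defensive.

Import Order.TTheory GRing.Theory Num.Theory.
Import numFieldNormedType.Exports.

Local Open Scope classical_set_scope.
Local Open Scope ring_scope.

(* [u]_alpha; only used for alpha in [0, 1]. *)
Definition level (R : realType) (u : R -> R) (alpha : R) : set R :=
  if alpha == 0 then closure [set x | 0 < u x] else [set x | alpha <= u x].

(* u^-(alpha) and u^+(alpha): for a nonempty compact interval, inf and sup are
   its end points. *)
Definition lend (R : realType) (u : R -> R) (alpha : R) : R :=
  inf (level u alpha).

Definition rend (R : realType) (u : R -> R) (alpha : R) : R :=
  sup (level u alpha).

Definition fuzzy_number (R : realType) (u : R -> R) : Prop :=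
  [/\ forall x, 0 <= u x <= 1,
      level u 1 !=set0
    & forall alpha, 0 <= alpha <= 1 ->
        level u alpha = `[lend u alpha, rend u alpha]%classic].

(* The Lipschitz condition is imposed on the support [u]_0 only, so u may jump
   at the two end points of its support. *)
Definition lipschitz_fuzzy_number_with (R : realType) (K : R) (u : R -> R)
    : Prop :=
  fuzzy_number u /\ K.-lipschitz_(level u 0) u.

Definition lipschitz_fuzzy_number (R : realType) (u : R -> R) : Prop :=
  exists K : R, lipschitz_fuzzy_number_with K u.

(* The supremum is taken over a nonempty set, bounded by 1 for fuzzy numbers,
   so that the total operator sup on R is the actual supremum. *)
Definition supmin_conv (R : realType) (u v : R -> R) (x : R) : R :=
  sup [set Num.min (u y) (v (x - y)) | y in [set: R]].

(* Main.v *)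
(** The identity [[u \nabla v]_alpha = [u]_alpha + [v]_alpha] shows that the
    convolution is a fuzzy number.  For the Lipschitz condition, let
    [x1 = y1 + z1] and let [x2 > x1] lie in the support of [u \nabla v].  Move
    from [x1] to [x2] by increasing [z1] only: [v] loses at most [K (x2 - x1)].
    If this would push [z1] beyond [v^+(0)], stop there and let [y1] absorb the
    rest: by quasi-concavity [u] does not drop below
    [min (u y1) (u (u^+(0)))], and [u (u^+(0)) >= v (v^+(0))].  The case
    [x2 < x1] is the mirror image. *)

Require Import Defs.
From mathcomp Require Import all_boot all_order all_algebra.
From mathcomp Require Import all_classical all_reals all_analysis.
From mathcomp Require Import lra.

Import Order.TTheory GRing.Theory Num.Theory.
Import numFieldNormedType.Exports.

Local Open Scope classical_set_scope.
Local Open Scope ring_scope.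

(** * Closures on the real line, sums of intervals, and level sets *)

Lemma closure_realP (R : realType) (A : set R) (x : R) :
  closure A x <-> forall e, 0 < e -> exists2 y, A y & `|x - y| < e.
Proof.
split=> [clA e e0|clA B /nbhs_ballP[e /= e0 eB]].
  by have [y [Ay xy]] := clA _ (nbhsx_ballx x e e0); exists y.
by have [y Ay xy] := clA e e0; exists y; split=> //; apply: eB.
Qed.

(** Greedy choice: [y = a], unless [z = x - a] would then exceed [d], in which case [z = d]. *)
Lemma itvcc_add (R : realDomainType) (a b c d x : R) :
  a <= b -> c <= d -> a + c <= x <= b + d ->
  exists y z, [/\ a <= y <= b, c <= z <= d & y + z = x].
Proof.
move=> ab cd /andP[ax xb]; have [h|h] := leP (x - d) a.
  by exists a, (x - a); split; lra.
by exists (x - d), d; split; lra.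
Qed.

Lemma level_pos (R : realType) (u : R -> R) (a : R) :
  0 < a -> level u a = [set x | a <= u x].
Proof. by move=> a0; rewrite /level gt_eqF. Qed.

Lemma level0 (R : realType) (u : R -> R) :
  level u 0 = closure [set x | 0 < u x].
Proof. by rewrite /level eqxx. Qed.

Lemma level_itvE (R : realType) (u : R -> R) (alpha a b : R) :
  a <= b -> level u alpha = `[a, b]%classic ->
  level u alpha = `[lend u alpha, rend u alpha]%classic.
Proof. by move=> ab E; rewrite /lend /rend E inf_itvcc ?sup_itvcc. Qed.

(** * Order properties of a single fuzzy number *)

Section FuzzyNumber.
Variables (R : realType) (u : R -> R).
Hypothesis hu : fuzzy_number u.

Lemma fuzzy_ge0 x : 0 <= u x.
Proof. by case: hu => /(_ x) /andP[]. Qed.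

Lemma fuzzy_le1 x : u x <= 1.
Proof. by case: hu => /(_ x) /andP[]. Qed.

Lemma fuzzy_levelP alpha x : 0 <= alpha <= 1 ->
  level u alpha x <-> lend u alpha <= x <= rend u alpha.
Proof.
by move=> h; case: hu => _ _ /(_ _ h) {1}->; rewrite /= in_itv.
Qed.

Lemma fuzzy_geP alpha x : 0 < alpha <= 1 ->
  (alpha <= u x) = (lend u alpha <= x <= rend u alpha).
Proof.
move=> /andP[a0 a1].
have /(fuzzy_levelP alpha x) : 0 <= alpha <= 1 by rewrite (ltW a0).
by rewrite level_pos// => h; apply/idP/idP => /h.
Qed.

Lemma fuzzy_supportP x : 0 < u x -> lend u 0 <= x <= rend u 0.
Proof.
move=> ux; apply/fuzzy_levelP; first by rewrite lexx ler01.
by rewrite level0; apply: subset_closure.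
Qed.

Lemma fuzzy_core : exists x, u x = 1.
Proof.
case: hu => _ [x]; rewrite level_pos//= => h _.
by exists x; apply/le_anti; rewrite fuzzy_le1.
Qed.

Lemma fuzzy_lend_le_rend alpha : 0 <= alpha <= 1 ->
  lend u alpha <= rend u alpha.
Proof.
move=> /andP[a0 a1]; have [x ux] := fuzzy_core.
suff : lend u alpha <= x <= rend u alpha by case/andP; exact: le_trans.
move: a0; rewrite le_eqVlt => /predU1P[<-|a0].
  by apply: fuzzy_supportP; rewrite ux.
by rewrite -fuzzy_geP ?a0// ux.
Qed.

(** For a positive minimum [m], the level set at [m] is an interval containing [a] and [b], hence
    also [y]. *)
Lemma fuzzy_quasiconcave a y b :
  a <= y <= b -> Num.min (u a) (u b) <= u y.
Proof.
move=> /andP[ay yb]; set m := Num.min _ _.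
have [m0|m0] := leP m 0; first exact: le_trans (fuzzy_ge0 y).
have m1 : 0 < m <= 1 by rewrite m0 ge_min fuzzy_le1.
have : m <= u a by rewrite ge_min lexx.
have : m <= u b by rewrite ge_min lexx orbT.
rewrite !fuzzy_geP// => /andP[_ br] /andP[al _].
by rewrite (le_trans al ay) (le_trans yb br).
Qed.

(** Quasi-concavity between [y] and [lend u alpha] bounds one of the two end values by [u p]. It
    cannot be the value at [lend u alpha], which is at least [alpha]. *)
Lemma fuzzy_left alpha p : 0 < alpha <= 1 -> p < lend u alpha ->
  u p < alpha /\ forall y, y <= p -> u y <= u p.
Proof.
move=> a01 pl; have up : u p < alpha.
  by rewrite ltNge fuzzy_geP// [lend _ _ <= p]leNgt pl.
split=> // y yp; have /andP[a0 a1] := a01.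
have : alpha <= u (lend u alpha).
  by rewrite fuzzy_geP// lexx fuzzy_lend_le_rend// (ltW a0).
have : Num.min (u y) (u (lend u alpha)) <= u p.
  by apply: fuzzy_quasiconcave; rewrite yp ltW.
by rewrite ge_min => /orP[//|]; lra.
Qed.

Lemma fuzzy_right alpha p : 0 < alpha <= 1 -> rend u alpha < p ->
  u p < alpha /\ forall y, p <= y -> u y <= u p.
Proof.
move=> a01 pr; have up : u p < alpha.
  by rewrite ltNge fuzzy_geP// [p <= rend _ _]leNgt pr andbF.
split=> // y py; have /andP[a0 a1] := a01.
have : alpha <= u (rend u alpha).
  by rewrite fuzzy_geP// lexx fuzzy_lend_le_rend// (ltW a0).
have : Num.min (u (rend u alpha)) (u y) <= u p.
  by apply: fuzzy_quasiconcave; rewrite py ltW.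
by rewrite ge_min => /orP[|//]; lra.
Qed.

End FuzzyNumber.

(** * Level sets of the sup-min convolution *)

Section Convolution.
Variables (R : realType) (u v : R -> R).
Hypotheses (hu : fuzzy_number u) (hv : fuzzy_number v).
Local Notation w := (supmin_conv u v).

Lemma supmin_conv_ge x y : Num.min (u y) (v (x - y)) <= w x.
Proof.
apply: ub_le_sup; last by exists y.
by exists 1 => _ [z _ <-]; rewrite ge_min fuzzy_le1.
Qed.

Lemma supmin_conv_ge_add y z m : m <= u y -> m <= v z -> m <= w (y + z).
Proof.
move=> uy vz; apply: le_trans (supmin_conv_ge (y + z) y).
by rewrite le_min uy addrC addKr.
Qed.

Lemma supmin_conv_le x m :
  (forall y, Num.min (u y) (v (x - y)) <= m) -> w x <= m.
Proof.
move=> h; apply: ge_sup; first by exists (Num.min (u 0) (v (x - 0))), 0.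
by move=> _ [y _ <-].
Qed.

Lemma supmin_conv_ge0 x : 0 <= w x.
Proof.
by apply: le_trans (supmin_conv_ge x 0); rewrite le_min !fuzzy_ge0.
Qed.

Lemma supmin_conv_le1 x : w x <= 1.
Proof. by apply: supmin_conv_le => y; rewrite ge_min fuzzy_le1. Qed.

(* If [p < u^-(alpha)] and [q < v^-(alpha)], then [max (u p) (v q) < alpha]
   bounds [min (u y) (v (p + q - y))] for all [y], so that no compactness
   argument is needed for the supremum. *)
Lemma supmin_conv_lt_left alpha x : 0 < alpha <= 1 ->
  x < lend u alpha + lend v alpha -> w x < alpha.
Proof.
(* Half the gap: the points [lend u alpha - e] and [lend v alpha - e] add up to [x], so for every
   [y] either [y] or [x - y] is at most the corresponding point. *)
move=> a01 xl; pose e := (lend u alpha + lend v alpha - x) / 2.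
have e0 : 0 < e by rewrite /e; lra.
have [ub um] := fuzzy_left _ _ hu _ (lend u alpha - e) a01 ltac:(lra).
have [vb vm] := fuzzy_left _ _ hv _ (lend v alpha - e) a01 ltac:(lra).
apply: (@le_lt_trans _ _ (Num.max (u (lend u alpha - e)) (v (lend v alpha - e)))).
  apply: supmin_conv_le => y; rewrite le_max !ge_min.
  have [h|h] := leP y (lend u alpha - e); first by rewrite um.
  by rewrite [v _ <= v _]vm ?orbT// /e; rewrite /e in h; lra.
by rewrite gt_max ub.
Qed.

Lemma supmin_conv_lt_right alpha x : 0 < alpha <= 1 ->
  rend u alpha + rend v alpha < x -> w x < alpha.
Proof.
move=> a01 xl; pose e := (x - (rend u alpha + rend v alpha)) / 2.
have e0 : 0 < e by rewrite /e; lra.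
have [ub um] := fuzzy_right _ _ hu _ (rend u alpha + e) a01 ltac:(lra).
have [vb vm] := fuzzy_right _ _ hv _ (rend v alpha + e) a01 ltac:(lra).
apply: (@le_lt_trans _ _ (Num.max (u (rend u alpha + e)) (v (rend v alpha + e)))).
  apply: supmin_conv_le => y; rewrite le_max !ge_min.
  have [h|h] := leP (rend u alpha + e) y; first by rewrite um.
  by rewrite [v _ <= v _]vm ?orbT// /e; rewrite /e in h; lra.
by rewrite gt_max ub.
Qed.

Lemma level_supmin_conv_pos alpha : 0 < alpha <= 1 ->
  level w alpha =
  `[lend u alpha + lend v alpha, rend u alpha + rend v alpha]%classic.
Proof.
move=> a01; have /andP[a0 a1] := a01.
have ale : 0 <= alpha <= 1 by rewrite (ltW a0).
rewrite level_pos//; apply/seteqP; split=> x /=; rewrite in_itv /=.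
  move=> wx; apply/andP; split; rewrite leNgt; apply/negP => h.
    by have := supmin_conv_lt_left _ _ a01 h; rewrite ltNge wx.
  by have := supmin_conv_lt_right _ _ a01 h; rewrite ltNge wx.
move=> /itvcc_add[||y [z [yu zv <-]]]; rewrite ?fuzzy_lend_le_rend//.
by apply: supmin_conv_ge_add; rewrite fuzzy_geP.
Qed.

Lemma supmin_conv_gt0 x : 0 < w x ->
  exists y, 0 < Num.min (u y) (v (x - y)).
Proof.
move=> wx; apply: contrapT => h; move: wx; rewrite ltNge => /negP; apply.
apply: supmin_conv_le => y; rewrite leNgt; apply/negP => hy.
by apply: h; exists y.
Qed.

(** The level at 0 is a closure, so it is treated apart. One inclusion holds because the interval is
    closed and contains all points where [w] is positive; for the other, both summands are
    approximated within [e / 2] by points of positive value. *)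
Lemma level_supmin_conv0 :
  level w 0 = `[lend u 0 + lend v 0, rend u 0 + rend v 0]%classic.
Proof.
have z01 : 0 <= (0 : R) <= 1 by rewrite lexx ler01.
rewrite level0; apply/seteqP; split.
  rewrite [X in _ `<=` X](closure_id _).1; last exact: itv_closed.
  apply: closure_subset => x /= /supmin_conv_gt0[y].
  rewrite lt_min in_itv /= => /andP[/(fuzzy_supportP _ _ hu) yu].
  by move=> /(fuzzy_supportP _ _ hv) yv; lra.
move=> x /=; rewrite in_itv /=.
move=> /itvcc_add[||y [z [yu zv <-]]]; rewrite ?fuzzy_lend_le_rend//.
move: yu zv => /(fuzzy_levelP _ _ hu _ _ z01) + /(fuzzy_levelP _ _ hv _ _ z01).
rewrite !level0 => /closure_realP yu /closure_realP zv.
apply/closure_realP => e e0; have e20 : 0 < e / 2 by lra.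
have [y' uy' yy'] := yu _ e20; have [z' vz' zz'] := zv _ e20.
exists (y' + z') => /=.
  apply: (@lt_le_trans _ _ (Num.min (u y') (v z'))).
    by rewrite lt_min uy' vz'.
  by apply: supmin_conv_ge_add; rewrite ge_min lexx ?orbT.
rewrite opprD addrACA (le_lt_trans (ler_normD _ _))//; lra.
Qed.

Lemma fuzzy_supmin_conv : fuzzy_number w.
Proof.
have wl alpha : 0 <= alpha <= 1 -> level w alpha =
    `[lend u alpha + lend v alpha, rend u alpha + rend v alpha]%classic.
  move=> /andP[]; rewrite le_eqVlt => /predU1P[<- _|a0 a1].
    exact: level_supmin_conv0.
  by apply: level_supmin_conv_pos; rewrite a0.
split=> [x||alpha a01].
- by rewrite supmin_conv_ge0 supmin_conv_le1.
- have [[y uy] [z vz]] := (fuzzy_core _ _ hu, fuzzy_core _ _ hv).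
  exists (y + z); rewrite level_pos//=.
  by apply: supmin_conv_ge_add; rewrite ?uy ?vz.
- by apply: level_itvE (wl _ a01); rewrite lerD ?fuzzy_lend_le_rend.
Qed.

End Convolution.

(** * Moving a decomposition [y1 + z1] to a new sum [x2] *)

Lemma min_shift_right (R : realType) (u v : R -> R) (K bu bv y1 z1 x2 : R) :
  0 <= K -> y1 <= bu -> z1 <= bv -> y1 + z1 <= x2 <= bu + bv ->
  (forall z, z1 <= z <= bv -> v z1 - K * (z - z1) <= v z) ->
  (forall y, y1 <= y <= bu -> Num.min (u y1) (u bu) <= u y) ->
  v bv <= u bu ->
  exists y2, Num.min (u y1) (v z1) - K * (x2 - (y1 + z1)) <=
             Num.min (u y2) (v (x2 - y2)).
Proof.
move=> K0 yb zb /andP[x1 xb] vL uq vu; set m := Num.min (u y1) (v z1).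
have mu : m <= u y1 by rewrite ge_min lexx.
have mv : m <= v z1 by rewrite ge_min lexx orbT.
have Kd : 0 <= K * (x2 - (y1 + z1)) by rewrite mulr_ge0// subr_ge0.
have [h|h] := leP (x2 - y1) bv.
  exists y1; have := vL (x2 - y1) ltac:(lra).
  by rewrite le_min [x2 - y1 - z1](_ : _ = x2 - (y1 + z1)); lra.
(* The second summand stops at [bv], and the first one takes the remaining [x2 - bv], which lies
   between [y1] and [bu]. *)
exists (x2 - bv).
have -> : x2 - (x2 - bv) = bv by lra.
have vbv : v z1 - K * (bv - z1) <= v bv by apply: vL; rewrite zb lexx.
have Kle : K * (bv - z1) <= K * (x2 - (y1 + z1)) by rewrite ler_wpM2l//; lra.
(* The value of [u] at [x2 - bv] is at least [u y1], hence at least [m], or at least [u bu], hence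
   at least [v bv]. *)
have := uq (x2 - bv) ltac:(lra).
by rewrite le_min ge_min => /orP[] ?; apply/andP; split; lra.
Qed.

(** Follows from [min_shift_right] by the reflection [x -> - x]. As that lemma assumes only
    inequalities, the reflected functions need not be shown to be fuzzy numbers. *)
Lemma min_shift_left (R : realType) (u v : R -> R) (K au av y1 z1 x2 : R) :
  0 <= K -> au <= y1 -> av <= z1 -> au + av <= x2 <= y1 + z1 ->
  (forall z, av <= z <= z1 -> v z1 - K * (z1 - z) <= v z) ->
  (forall y, au <= y <= y1 -> Num.min (u au) (u y1) <= u y) ->
  v av <= u au ->
  exists y2, Num.min (u y1) (v z1) - K * (y1 + z1 - x2) <=
             Num.min (u y2) (v (x2 - y2)).
Proof.
move=> K0 yb zb xb vL uq vu.
have [||||||y2] := @min_shift_right R (u \o -%R) (v \o -%R) K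
  (- au) (- av) (- y1) (- z1) (- x2) K0; rewrite /= ?opprK; try lra.
- move=> z hz; have := vL (- z) ltac:(lra).
  by rewrite opprK [z1 + z]addrC.
- by move=> y hy; rewrite minC; apply: uq; lra.
rewrite [- x2 - _](_ : _ = y1 + z1 - x2); last by lra.
rewrite [- (- x2 - y2)](_ : _ = x2 - - y2); last by lra.
by exists (- y2).
Qed.

Theorem theorem6p2 (R : realType) (u v : R -> R) (K : R)
    (hu : fuzzy_number u)
    (hv : lipschitz_fuzzy_number_with K v)
    (hl : v (lend v 0) <= u (lend u 0))
    (hr : v (rend v 0) <= u (rend u 0)) :
  lipschitz_fuzzy_number (supmin_conv u v).
Proof.
have [fv lv] := hv; have z01 : 0 <= (0 : R) <= 1 by rewrite lexx ler01.
(* The absolute value supplies the nonnegative constant that the shifting lemmas require. *)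
exists `|K|; split; first exact: fuzzy_supmin_conv.
have vL z z' : lend v 0 <= z <= rend v 0 -> lend v 0 <= z' <= rend v 0 ->
    v z - v z' <= `|K| * `|z - z'|.
  move=> /(fuzzy_levelP _ _ fv _ _ z01) hz /(fuzzy_levelP _ _ fv _ _ z01) hz'.
  apply: le_trans (ler_norm _) _.
  apply: le_trans (lv (z, z') (conj hz hz')) _.
  by rewrite ler_wpM2r// ler_norm.
(* A one-sided estimate is enough, since it can be applied with the two points exchanged. *)
suff wL x1 x2 : level (supmin_conv u v) 0 x2 ->
    supmin_conv u v x1 - supmin_conv u v x2 <= `|K| * `|x1 - x2|.
  move=> [x1 x2] /= [h1 h2]; rewrite ler_norml wL// andbT.
  by rewrite lerNl opprB distrC wL.
rewrite level_supmin_conv0//= in_itv /= => hx2; rewrite lerBlDr.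
apply: supmin_conv_le => y1; set m := Num.min _ _.
(* A nonpositive [m] is below the nonnegative right-hand side; a positive one places [y1] and
   [x1 - y1] in the supports of [u] and [v]. *)
have [m0|] := leP m 0.
  by rewrite (le_trans m0)// addr_ge0 ?mulr_ge0// supmin_conv_ge0.
rewrite lt_min => /andP[/(fuzzy_supportP _ _ hu) hy /(fuzzy_supportP _ _ fv) hz].
suff [y2 hy2] : exists y2, m - `|K| * `|x1 - x2| <=
    Num.min (u y2) (v (x2 - y2)).
  by have := supmin_conv_ge _ u v hu x2 y2; lra.
(* Used to write [x1] as the sum [y1 + z1] that the shifting lemmas expect, with [z1 = x1 - y1]. *)
have ex : y1 + (x1 - y1) = x1 by lra.
have [x12|x21] := leP x1 x2.
- rewrite distrC [`|x2 - x1|]ger0_norm ?subr_ge0// -[in x2 - x1]ex.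
  apply: (@min_shift_right _ _ _ _ (rend u 0) (rend v 0)) => //; try lra.
  + move=> z hz'; have := vL (x1 - y1) z hz ltac:(lra).
    by rewrite distrC [`|z - _|]ger0_norm; lra.
  + by move=> y; apply: fuzzy_quasiconcave.
- rewrite [`|x1 - x2|]gtr0_norm ?subr_gt0// -[in x1 - x2]ex.
  apply: (@min_shift_left _ _ _ _ (lend u 0) (lend v 0)) => //; try lra.
  + move=> z hz'; have := vL (x1 - y1) z hz ltac:(lra).
    by rewrite [`|_ - z|]ger0_norm; lra.
  + by move=> y; apply: fuzzy_quasiconcave.
Qed.
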